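(* Let $\Delta$ be a connected simplicial complex whose vertices are labelled (possibly with repetitions) by $1,\dots,n$. Then the tangential variety of $V_\Delta$ is isomorphic to the product of $\mathbb{C}^n$ and the variety $T_\Delta$.
   Context: A simplicial complex is a finite collection of subsets (simplices) of a vertex set, closed under taking subsets; the empty simplex is included and $\dim\sigma=|\sigma|-1$. Here $\Delta$ is a simplicial complex each of whose vertices carries a label in $\{1,\dots,n\}$, every label being used; repeated labels are allowed. Two simplices with the same multiset of labels are identified, and $N$ denotes the number of distinct simplices after this identification (the empty simplex included). A product $\prod_{i\in\sigma}$ runs over the labels of the vertices of $\sigma$ with multiplicity. The complex $\Delta$ defines the embedding $e_\Delta:\mathbb{C}^n\to\mathbb{C}^N$, $\mathbf t\mapsto(x_\sigma)_{\sigma\in\Delta}$, $x_\sigma=\prod_{i\in\sigma}t_i$ (so $x_\emptyset=1$), and $V_\Delta=\overline{e_\Delta(\mathbb{C}^n)}$ (Zariski closure). Let $\Delta_{\ge 2}$ be the set of simplices of $\Delta$ of dimension at least one. The affine toric variety $T_\Delta\subset\mathbb{C}^{N-n-1}$ is the Zariski closure of the image of $\mathbf t\mapsto(\prod_{i\in\sigma}t_i)_{\sigma\in\Delta_{\ge2}}$. The tangential variety of a variety $Y$ is the union of all tangent lines to $Y$.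
   Formalization: The tangential variety is taken as the Zariski closure of the union of all tangent lines; the union itself need not be closed, and for the boundary of a triangle with labels 1, 2, 3 the claim fails for the bare union. *)

(* Defs.v *)
From HB Require Import structures.
From mathcomp Require Import all_boot all_order all_algebra.
From mathcomp Require Import complex mpoly.
From mathcomp Require Import classical_sets reals.

Set Implicit Arguments.
Unset Strict Implicit.
Unset Printing Implicit Defensive.

Import GRing.Theory.
Local Open Scope ring_scope.

Section AffineVarieties.
Context {K : fieldType}.

Definition vanishes_on N (p : {mpoly K[N]}) (A : set 'rV[K]_N) : Prop :=
  forall x, A x -> p.@[x 0] = 0.

Definition zariski_closure N (A : set 'rV[K]_N) : set 'rV[K]_N :=
  fun x => forall p : {mpoly K[N]}, vanishes_on p A -> p.@[x 0] = 0.

(* [v] is a tangent vector of [Y] at [y]: it is killed by the differentials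
   at [y] of all polynomials in the ideal of [Y]. *)
Definition tangent_vector N (Y : set 'rV[K]_N) (y v : 'rV[K]_N) : Prop :=
  forall p : {mpoly K[N]}, vanishes_on p Y ->
    \sum_(i < N) (p^`M(i)).@[y 0] * v 0 i = 0.

Definition line N (y v : 'rV[K]_N) : set 'rV[K]_N :=
  fun x => exists s : K, x = y + s *: v.

Definition tangent_lines_union N (Y : set 'rV[K]_N) : set 'rV[K]_N :=
  fun x => exists y v : 'rV[K]_N,
    [/\ Y y, v != 0, tangent_vector Y y v & line y v x].

(* The union of the tangent lines is in general only constructible, so the
   variety it defines is its Zariski closure.  For the boundary of a triangle
   with distinct labels the union is not even locally closed: in suitable
   coordinates it is K^3 times the set of (a, b, c) that do not have exactly
   one zero entry. *)
Definition tangential_variety N (Y : set 'rV[K]_N) : set 'rV[K]_N :=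
  zariski_closure (tangent_lines_union Y).

Definition variety_prod M N (X : set 'rV[K]_M) (Y : set 'rV[K]_N) :
    set 'rV[K]_(M + N) :=
  fun z => X (lsubmx z) /\ Y (rsubmx z).

Definition polynomial_map M N (f : 'rV[K]_M -> 'rV[K]_N) : Prop :=
  exists P : 'I_N -> {mpoly K[M]}, forall x, f x = \row_j (P j).@[x 0].

(* Morphisms of closed subvarieties of affine spaces are the restrictions of
   polynomial maps between the ambient spaces. *)
Definition variety_isomorphic M N (X : set 'rV[K]_M) (Y : set 'rV[K]_N) :
    Prop :=
  exists (f : 'rV[K]_M -> 'rV[K]_N) (g : 'rV[K]_N -> 'rV[K]_M),
    [/\ polynomial_map f, polynomial_map g,
        forall x, X x -> Y (f x) /\ g (f x) = x &
        forall y, Y y -> X (g y) /\ f (g y) = y].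

(* The map t |-> (t^a)_(a in A) for a list A of exponent vectors. *)
Definition monomial_map n (A : seq 'X_{1..n}) (t : 'rV[K]_n) :
    'rV[K]_(size A) :=
  \row_j \prod_(i < n) t 0 i ^+ (nth 0%MM A j) i.

End AffineVarieties.

Section LabelledComplexes.
Variables (n : nat) (V : finType).
Implicit Types (D : {set {set V}}) (lab : V -> 'I_n).

Definition simplicial_complex D : Prop :=
  [/\ finset.set0 \in D,
      forall s t : {set V}, t \subset s -> s \in D -> t \in D &
      forall v : V, finset.set1 v \in D].

Definition complex_edge D : rel V :=
  [rel v w | finset.setU (finset.set1 v) (finset.set1 w) \in D].

(* As usual a connected complex is nonempty, i.e. has a vertex. *)
Definition complex_connected D : Prop :=
  (0 < #|V|)%N /\ forall v w : V, connect (complex_edge D) v w.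

(* A multiset of labels is encoded by its multiplicities. *)
Definition label_multiset lab (s : {set V}) : 'X_{1..n} :=
  [multinom #|[pred v in s | lab v == i]| | i < n].

(* The simplices of D after identifying those with equal multisets of labels,
   listed without repetition in some order; the size of this list is the
   number N. *)
Definition label_classes lab D : seq 'X_{1..n} :=
  undup [seq label_multiset lab s | s in D].

Definition dim_ge1 D : {set {set V}} :=
  finset (fun s => (s \in D) && (2 <= #|s|)%N).

Definition V_Delta (K : fieldType) lab D :
    set 'rV[K]_(size (label_classes lab D)) :=
  zariski_closure (range (monomial_map (label_classes lab D))).

Definition T_Delta (K : fieldType) lab D :
    set 'rV[K]_(size (label_classes lab (dim_ge1 D))) :=
  zariski_closure (range (monomial_map (label_classes lab (dim_ge1 D)))).

(* The ambient space of [T_Delta] is K^(N - n - 1). *)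
Lemma size_label_classes_dim_ge1 lab D :
  simplicial_complex D -> (forall i, exists v, lab v = i) ->
  size (label_classes lab (dim_ge1 D)) =
    (size (label_classes lab D) - n - 1)%N.
Proof.
move=> [D0 _ D1] labS.
have ms0 : label_multiset lab finset.set0 = 0%MM.
  apply/mnmP=> i; rewrite mnmE mnm0E; apply: eq_card0 => v.
  by rewrite !inE.
have ms1 v : label_multiset lab (finset.set1 v) = U_(lab v)%MM.
  apply/mnmP=> i; rewrite mnmE mnm1E; case: eqP => [<-|ne].
    rewrite -[RHS](card1 v); apply: eq_card => w; rewrite !inE.
    by case: (w =P v) => // ->; rewrite eqxx.
  apply: eq_card0 => w; rewrite !inE; case: (w =P v) => // ->.
  exact/eqP.
have deg (s : {set V}) : mdeg (label_multiset lab s) = #|s|.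
  rewrite mdegE -sum1_card (partition_big lab predT) //=.
  by apply: eq_bigr => i _; rewrite mnmE -sum1_card; apply: eq_bigl => v; rewrite !inE.
have mem D' m : reflect (exists2 s, s \in D' & m = label_multiset lab s)
    (m \in label_classes lab D').
  rewrite mem_undup; apply: (iffP mapP) => -[s sD ->].
    by exists s; rewrite // -mem_enum.
  by exists s; rewrite // mem_enum.
suff /perm_size -> : perm_eq (label_classes lab D)
    (0%MM :: [seq U_(i)%MM | i <- enum 'I_n] ++ label_classes lab (dim_ge1 D)).
  by rewrite /= size_cat size_map size_enum_ord -addnS addKn subn1.
have small m : m \in label_classes lab (dim_ge1 D) -> (1 < mdeg m)%N.
  by case/mem=> s; rewrite inE => /andP[_ ?] ->; rewrite deg.
apply: uniq_perm; first exact: undup_uniq.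
  rewrite /= cat_uniq mem_cat negb_or undup_uniq andbT.
  rewrite (map_inj_uniq _) ?enum_uniq ?andbT; last first.
    by move=> i j /eqP; rewrite eq_mnm1 => /eqP.
  apply/andP; split; [apply/andP; split|].
  - by apply/mapP => -[i _ /(congr1 (@mdeg n))]; rewrite mdeg0 mdeg1.
  - by apply/negP => /small; rewrite mdeg0.
  - apply/hasPn => m /small lt1; apply/mapP => -[i _ E].
    by move: lt1; rewrite E mdeg1.
move=> m; rewrite inE mem_cat; apply/mem/idP => [[s sD ->]|].
  have [lt1|] := ltnP 1 #|s|.
    by apply/orP; right; apply/orP; right; apply/mem; exists s; rewrite ?inE ?sD.
  rewrite leq_eqVlt ltnS leqn0 => /orP[/cards1P[v ->]|].
    apply/orP; right; apply/orP; left; rewrite ms1.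
    by apply: map_f; rewrite mem_enum.
  by rewrite cards_eq0 => /eqP->; rewrite ms0 eqxx.
case/or3P=> [/eqP->|/mapP[i _ ->]|/mem[s]].
- by exists finset.set0; rewrite ?ms0.
- by have [v <-] := labS i; exists (finset.set1 v); rewrite ?ms1.
- by rewrite inE => /andP[sD _] ->; exists s.
Qed.

End LabelledComplexes.

Arguments V_Delta {n V} K lab D _.
Arguments T_Delta {n V} K lab D _.

(* Main.v *)
Require Import Defs.
From HB Require Import structures.
From mathcomp Require Import all_boot all_order all_algebra.
From mathcomp Require Import complex mpoly.
From mathcomp Require Import classical_sets reals.

(* V_Delta is the graph of a monomial map, so the points on its tangent lines
   are exactly the vectors of "moments" x_a = t^a + d_v t^a, where a runs over
   the label multisets and t, v over K^n.  The mean of the functional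
   p |-> p(t) + d_v p(t) is u = t + v.  Replace the moments by the central
   moments c_a = sum_(b <= a) binom(a, b) (- u)^(a - b) x_b; this is a
   polynomial change of coordinates, with inverse the same sum at + u, because
   the multisets below a label multiset are label multisets.  Recentring puts
   t at - v, hence c_a = (1 - |a|) (- v)^a, and dividing by 1 - |a|, nonzero
   for |a| >= 2, leaves the product of the free mean u and the monomials
   (- v)^a.  An isomorphism between these parametrized sets, given by
   polynomial maps in both directions, extends to their closures. *)

Set Implicit Arguments.
Unset Strict Implicit.
Unset Printing Implicit Defensive.

Import GRing.Theory Num.Theory.
Local Open Scope ring_scope.

(** * Polynomial maps, Zariski closures and polynomial curves *)

Lemma mpoly_ring_ind (R : comNzRingType) N (P : {mpoly R[N]} -> Prop) :
  (forall c, P c%:MP) -> (forall i, P 'X_i) ->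
  (forall p q, P p -> P q -> P (p + q)) ->
  (forall p q, P p -> P q -> P (p * q)) -> forall p, P p.
Proof.
move=> PC PX PD PM p; rewrite (mpolyE p).
apply: (big_ind P) => [|//|m _]; first by rewrite -mpolyC0; apply: PC.
rewrite -mul_mpolyC; apply: (PM); first exact: PC.
rewrite mpolyXE_id; apply: (big_ind P) => [|//|i _].
  by rewrite -mpolyC1; apply: PC.
by elim: (m i) => [|k IHk]; rewrite ?exprS -?mpolyC1; [apply: PC | apply: PM].
Qed.

Section PolynomialMaps.
Variable K : fieldType.

Definition polynomial_fun N (h : 'rV[K]_N -> K) : Prop :=
  exists P : {mpoly K[N]}, forall x, h x = P.@[x 0].

Lemma polynomial_fun_ext N (h h' : 'rV[K]_N -> K) :
  h =1 h' -> polynomial_fun h -> polynomial_fun h'.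
Proof. by move=> eqh [P hP]; exists P => x; rewrite -eqh. Qed.

Lemma polynomial_funC N (c : K) : polynomial_fun (fun _ : 'rV_N => c).
Proof. by exists c%:MP => x; rewrite mevalC. Qed.

Lemma polynomial_fun_coord N i : polynomial_fun (fun x : 'rV[K]_N => x 0 i).
Proof. by exists 'X_i => x; rewrite mevalXU. Qed.

Lemma polynomial_funD N (h h' : 'rV[K]_N -> K) :
  polynomial_fun h -> polynomial_fun h' ->
  polynomial_fun (fun x => h x + h' x).
Proof. by case=> [P hP] [Q hQ]; exists (P + Q) => x; rewrite mevalD hP hQ. Qed.

Lemma polynomial_funM N (h h' : 'rV[K]_N -> K) :
  polynomial_fun h -> polynomial_fun h' ->
  polynomial_fun (fun x => h x * h' x).
Proof. by case=> [P hP] [Q hQ]; exists (P * Q) => x; rewrite mevalM hP hQ. Qed.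

Lemma polynomial_funN N (h : 'rV[K]_N -> K) :
  polynomial_fun h -> polynomial_fun (fun x => - h x).
Proof. by case=> [P hP]; exists (- P) => x; rewrite mevalN hP. Qed.

Lemma polynomial_funX N (h : 'rV[K]_N -> K) k :
  polynomial_fun h -> polynomial_fun (fun x => h x ^+ k).
Proof. by case=> [P hP]; exists (P ^+ k) => x; rewrite rmorphXn /= hP. Qed.

Lemma polynomial_fun_sum N (I : Type) (r : seq I) (h : I -> 'rV[K]_N -> K) :
  (forall i, polynomial_fun (h i)) -> polynomial_fun (fun x => \sum_(i <- r) h i x).
Proof.
move=> ph; elim: r => [|i r IHr].
  by apply: polynomial_fun_ext (polynomial_funC N 0) => x; rewrite big_nil.
apply: polynomial_fun_ext (polynomial_funD (ph i) IHr) => x.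
by rewrite big_cons.
Qed.

Lemma polynomial_fun_prod N (I : Type) (r : seq I) (h : I -> 'rV[K]_N -> K) :
  (forall i, polynomial_fun (h i)) -> polynomial_fun (fun x => \prod_(i <- r) h i x).
Proof.
move=> ph; elim: r => [|i r IHr].
  by apply: polynomial_fun_ext (polynomial_funC N 1) => x; rewrite big_nil.
apply: polynomial_fun_ext (polynomial_funM (ph i) IHr) => x.
by rewrite big_cons.
Qed.

Lemma polynomial_mapP M N (f : 'rV[K]_M -> 'rV[K]_N) :
  polynomial_map f <-> forall j, polynomial_fun (fun x => f x 0 j).
Proof.
split=> [[P fP] j|/fin_all_exists[P fP]].
  by exists (P j) => x; rewrite fP mxE.
by exists P => x; apply/rowP => j; rewrite mxE fP.
Qed.

Lemma polynomial_map_id N : polynomial_map (@idfun 'rV[K]_N).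
Proof. by apply/polynomial_mapP => j; apply: polynomial_fun_coord. Qed.

Lemma polynomial_fun_comp M N (h : 'rV[K]_N -> K) (f : 'rV[K]_M -> 'rV[K]_N) :
  polynomial_fun h -> polynomial_map f -> polynomial_fun (h \o f).
Proof.
case=> [Q hQ] [P fP]; exists (Q \mPo (mktuple P)) => x.
rewrite comp_mpoly_meval /= hQ; apply: meval_eq => j.
by rewrite fP mxE tnth_mktuple.
Qed.

Lemma polynomial_map_comp L M N (f : 'rV[K]_M -> 'rV[K]_N)
    (g : 'rV[K]_L -> 'rV[K]_M) :
  polynomial_map f -> polynomial_map g -> polynomial_map (f \o g).
Proof.
by move=> /polynomial_mapP pf pg; apply/polynomial_mapP => j;
  apply: polynomial_fun_comp (pf j) pg.
Qed.

Lemma polynomial_map_row_mx L M N (f : 'rV[K]_L -> 'rV[K]_M)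
    (g : 'rV[K]_L -> 'rV[K]_N) :
  polynomial_map f -> polynomial_map g ->
  polynomial_map (fun x => row_mx (f x) (g x)).
Proof.
move=> /polynomial_mapP pf /polynomial_mapP pg; apply/polynomial_mapP => j.
case: (split_ordP j) => k ->.
- by apply: polynomial_fun_ext (pf k) => x; rewrite row_mxEl.
- by apply: polynomial_fun_ext (pg k) => x; rewrite row_mxEr.
Qed.

Lemma polynomial_map_rsubmx M N :
  polynomial_map (fun z : 'rV[K]_(M + N) => rsubmx z).
Proof.
apply/polynomial_mapP => j.
by apply: polynomial_fun_ext (polynomial_fun_coord _) => x; rewrite mxE.
Qed.

Lemma polynomial_map_const M N (c : 'rV[K]_N) :
  polynomial_map (fun _ : 'rV[K]_M => c).
Proof. by apply/polynomial_mapP => j; apply: polynomial_funC. Qed.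

Lemma sub_zariski_closure N (A : set 'rV[K]_N) x :
  A x -> zariski_closure A x.
Proof. by move=> Ax p; apply. Qed.

(** A polynomial vanishing on [B], composed with [f], is a polynomial vanishing on [A]. *)
Lemma polynomial_map_closure M N (f : 'rV[K]_M -> 'rV[K]_N)
    (A : set 'rV[K]_M) (B : set 'rV[K]_N) :
  polynomial_map f -> (forall x, A x -> B (f x)) ->
  forall x, zariski_closure A x -> zariski_closure B (f x).
Proof.
move=> pf fAB x clx p pB.
have [|Q hQ] := @polynomial_fun_comp _ _ (fun y => p.@[y 0]) f _ pf.
  by exists p.
by rewrite -/((fun y : 'rV_N => p.@[y 0]) (f x)) [LHS]hQ; apply: clx => z Az;
  rewrite -hQ; apply/pB/fAB.
Qed.

(** The coordinates of [f - g] are polynomials that vanish on [A], hence on its closure. *)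
Lemma polynomial_map_eq_closure M N (f g : 'rV[K]_M -> 'rV[K]_N)
    (A : set 'rV[K]_M) :
  polynomial_map f -> polynomial_map g -> (forall x, A x -> f x = g x) ->
  forall x, zariski_closure A x -> f x = g x.
Proof.
move=> [P fP] [Q gQ] fgA x clx; rewrite fP gQ; apply/rowP => j; rewrite !mxE.
apply/eqP; rewrite -subr_eq0 -mevalB; apply/eqP/clx => y Ay.
have := congr1 (fun z : 'rV_N => z 0 j) (fgA y Ay).
by rewrite fP gQ !mxE mevalB => ->; rewrite subrr.
Qed.

(** The free factor is frozen: for each fixed [u] the map [y |-> g (row_mx u y)] is polynomial, so
    containments and identities pass from [B] to its closure, and no closure of a product has to be
    computed. *)
Lemma closure_isomorphic_setT_prod L M N (A : set 'rV[K]_M) (B : set 'rV[K]_N)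
    (f : 'rV[K]_M -> 'rV[K]_(L + N)) (g : 'rV[K]_(L + N) -> 'rV[K]_M) :
  polynomial_map f -> polynomial_map g ->
  (forall x, A x -> B (rsubmx (f x)) /\ g (f x) = x) ->
  (forall u y, B y -> A (g (row_mx u y)) /\ f (g (row_mx u y)) = row_mx u y) ->
  variety_isomorphic (zariski_closure A)
    (variety_prod [set: 'rV[K]_L]%classic (zariski_closure B)).
Proof.
move=> pf pg fA gB; exists f, g; split=> // [x clx|z [_ clz]].
  split; first split=> //.
    apply: (@polynomial_map_closure _ _ (fun x => rsubmx (f x))) clx.
      exact: polynomial_map_comp (@polynomial_map_rsubmx _ _) pf.
    by move=> y /fA[].
  apply: (@polynomial_map_eq_closure _ _ (g \o f) idfun) clx.
  - exact: polynomial_map_comp.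
  - exact: polynomial_map_id.
  - by move=> y /fA[].
have pr : polynomial_map (fun y : 'rV[K]_N => row_mx (lsubmx z) y).
  exact/polynomial_map_row_mx/polynomial_map_id/polynomial_map_const.
rewrite -[z]hsubmxK; split.
  apply: (@polynomial_map_closure _ _ (fun y => g (row_mx (lsubmx z) y))) clz.
    exact: polynomial_map_comp pg pr.
  by move=> y /(gB (lsubmx z))[].
apply: (@polynomial_map_eq_closure _ _
  (fun y => f (g (row_mx (lsubmx z) y))) (row_mx (lsubmx z))) clz => //.
  exact: polynomial_map_comp (polynomial_map_comp pf pg) pr.
by move=> y /(gB (lsubmx z))[].
Qed.

Lemma mmap_curveE N (p : {mpoly K[N]}) (q : 'I_N -> {poly K}) s :
  (mmap polyC q p).[s] = p.@[fun j => (q j).[s]].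
Proof.
elim/mpoly_ring_ind: p => [c|i|p1 p2 IH1 IH2|p1 p2 IH1 IH2].
- by rewrite mmapC mevalC hornerC.
- by rewrite mmapX mmap1U mevalXU.
- by rewrite mmapD mevalD hornerD IH1 IH2.
- by rewrite rmorphM mevalM hornerM IH1 IH2.
Qed.

(** The chain rule. Both sides are additive and obey the Leibniz rule, so it suffices to compare
    them on constants and variables. *)
Lemma mmap_curve_deriv N (p : {mpoly K[N]}) (q : 'I_N -> {poly K}) s :
  (mmap polyC q p)^`().[s] =
    \sum_(i < N) (p^`M(i)).@[fun j => (q j).[s]] * (q i)^`().[s].
Proof.
elim/mpoly_ring_ind: p => [c|i|p1 p2 IH1 IH2|p1 p2 IH1 IH2].
- rewrite mmapC derivC horner0 big1 // => i _.
  by rewrite mderivC meval0 mul0r.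
- rewrite mmapX mmap1U (bigD1 i) //= big1 => [|j /negPf ji].
    rewrite mderivX mnm1E eqxx scale1r (_ : U_(i) - U_(i) = 0)%MM.
      by rewrite mpolyX0 meval1 mul1r addr0.
    by apply/mnmP => k; rewrite mnmBE subnn mnm0E.
  by rewrite mderivX mnm1E eq_sym ji scale0r meval0 mul0r.
- rewrite mmapD derivD hornerD IH1 IH2 -big_split /=.
  by apply: eq_bigr => i _; rewrite mderivD mevalD mulrDl.
- rewrite rmorphM derivM hornerD !hornerM IH1 IH2 !mmap_curveE.
  rewrite mulr_suml mulr_sumr -big_split /=; apply: eq_bigr => i _.
  rewrite mderivM mevalD !mevalM mulrDl [in RHS]mulrAC -!mulrA; congr (_ + _).
Qed.

End PolynomialMaps.

(** * Moments under a translation *)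

Section BinomialTransform.
Variables (R : comNzRingType) (n : nat).
Implicit Types (A : seq 'X_{1..n}) (s t : 'I_n -> R) (a b : 'X_{1..n}).

(** If [F b] is the value of a linear functional at X^b, this is its value at (s + X)^a. Exponents
    [b] not below [a] contribute nothing, because some 'C(a i, b i) is then 0; the truncated
    subtraction does no harm. *)
Definition binomial_transform A s (F : 'X_{1..n} -> R) a : R :=
  \sum_(b <- A) (\prod_(i < n) (s i ^+ (a i - b i) *+ 'C(a i, b i))) * F b.

Lemma binomial_transform_monomial A s t a :
  uniq A -> (forall b, (b <= a)%MM -> b \in A) ->
  binomial_transform A s (fun b => \prod_(i < n) t i ^+ b i) a =
    \prod_(i < n) (s i + t i) ^+ a i.
Proof.
(* Every multi-index below [a] has entries less than [d], so it is a function into ['I_d]; sums over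
   such functions are what distributivity of products over sums handles. *)
move=> uA downA; pose d := (mdeg a).+1.
pose G i j := (s i ^+ (a i - j) * t i ^+ j) *+ 'C(a i, j).
pose H b := \prod_(i < n) G i (b i).
have H0 b : ~~ (b <= a)%MM -> H b = 0.
  apply: contraNeq => Hb; apply/mnm_lepP => i; rewrite leqNgt.
  apply: contraNN Hb => lt_ab.
  by rewrite /H (bigD1 i) //= /G bin_small ?mulr0n ?mul0r.
transitivity (\sum_(f : {ffun 'I_n -> 'I_d}) H [multinom (f i : nat) | i < n]).
  transitivity (\sum_(b <- A) H b).
    apply: eq_bigr => b _; rewrite -big_split /=; apply: eq_bigr => i _.
    by rewrite /G mulrnAl.
  transitivity (\sum_(b <- A)
    \sum_(f : {ffun 'I_n -> 'I_d} | [multinom (f i : nat) | i < n] == b) H b).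
    (* An exponent below [a] is encoded by exactly one function; for the others the summand is 0. *)
    apply: eq_bigr => b _; have [le_ba|/H0->] := boolP (b <= a)%MM; last first.
      by rewrite big1.
    have ltd i : (b i < d)%N.
      rewrite ltnS (leq_trans (mnm_lepP le_ba i)) //.
      by rewrite mdegE (bigD1 i) //= leq_addr.
    rewrite (big_pred1 [ffun i => Ordinal (ltd i)]) // => f /=.
    apply/eqP/eqP => [fb|->]; last by apply/mnmP => i; rewrite mnmE ffunE.
    apply/ffunP => i; apply: val_inj; have /mnmP/(_ i) := fb; rewrite mnmE.
    by rewrite ffunE.
  rewrite (exchange_big_dep predT) //=; apply: eq_bigr => f _.
  set m := (X in H X).
  (* The exponent encoded by [f] occurs once in [A], as [A] is duplicate-free, or is missing from
     [A]; in the latter case it is not below [a] and its term is 0. *)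
  have [mA|mA] := boolP (m \in A).
    rewrite -big_filter (@eq_filter _ _ (pred1 m)) => [|b]; last exact: eq_sym.
    by rewrite filter_pred1_uniq ?big_seq1.
  rewrite H0; last by apply: contra mA; apply: downA.
  rewrite big_seq_cond big1 // => b /andP[bA /eqP mb].
  by rewrite -mb (negPf mA) in bA.
transitivity (\prod_(i < n) \sum_(j < d) G i j).
  rewrite bigA_distr_bigA; apply: eq_bigr => f _.
  by apply: eq_bigr => i _; rewrite mnmE.
apply: eq_bigr => i _; rewrite exprDn.
rewrite (@big_ord_widen _ _ _ (a i).+1 d (G i)).
  rewrite [LHS](bigID (fun j : 'I_d => j < (a i).+1)%N) /= [X in _ + X]big1 ?addr0 //.
  by move=> j; rewrite -leqNgt => lt_aj; rewrite /G bin_small.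
by rewrite ltnS mdegE (bigD1 i) //= leq_addr.
Qed.

End BinomialTransform.

(** * Monomials restricted to a line, and their first-order values *)

Section TangentMonomials.
Variables (K : fieldType) (n : nat).
Implicit Types (s : K) (t u v : 'rV[K]_n) (a b : 'X_{1..n}).

Definition line_monomial t v b : {poly K} :=
  \prod_(i < n) ((t 0 i)%:P + v 0 i *: 'X) ^+ b i.

(* The monomial of exponent b under the functional p |-> p(t) + d_v p(t). *)
Definition tangent_monomial t v b : K :=
  (line_monomial t v b).[0] + (line_monomial t v b)^`().[0].

Lemma horner_line_monomial t v b s :
  (line_monomial t v b).[s] = \prod_(i < n) ((t + s *: v) 0 i) ^+ b i.
Proof.
rewrite horner_prod; apply: eq_bigr => i _.
by rewrite horner_exp hornerD hornerC hornerZ hornerX !mxE [s * _]mulrC.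
Qed.

Lemma line_monomialZ s t v b :
  line_monomial t (s *: v) b = line_monomial t v b \Po (s *: 'X).
Proof.
rewrite /line_monomial rmorph_prod; apply: eq_bigr => i _.
by rewrite rmorphXn /= comp_polyD comp_polyC comp_polyZ comp_polyX mxE
  scalerA mulrC.
Qed.

Lemma tangent_monomialZ s t v b :
  tangent_monomial t (s *: v) b =
    (line_monomial t v b).[0] + s * (line_monomial t v b)^`().[0].
Proof.
rewrite /tangent_monomial line_monomialZ deriv_comp derivZ derivX.
rewrite hornerM !horner_comp !hornerZ hornerX mulr0 hornerC mulr1.
by rewrite [_ * s]mulrC.
Qed.

Lemma line_monomial1 t v i :
  line_monomial t v U_(i) = (t 0 i)%:P + v 0 i *: 'X.
Proof.
rewrite /line_monomial (bigD1 i) //= big1 => [|j /negPf ji].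
  by rewrite mnm1E eqxx expr1 mulr1.
by rewrite mnm1E eq_sym ji.
Qed.

Lemma deriv_line_monomial1 t v i : (line_monomial t v U_(i))^`() = (v 0 i)%:P.
Proof.
by rewrite line_monomial1 derivD derivC derivZ derivX add0r alg_polyC.
Qed.

Lemma tangent_monomial1 t v i : tangent_monomial t v U_(i) = t 0 i + v 0 i.
Proof.
by rewrite /tangent_monomial deriv_line_monomial1 line_monomial1 !hornerE.
Qed.

(** The line from [t] in direction [- t] is t(1 - X), on which the monomial is t^b (1 - X)^|b|;
    value plus derivative at 0 gives the factor 1 - |b|. *)
Lemma tangent_monomial_cone t b :
  tangent_monomial t (- t) b =
    (1 - (mdeg b)%:R) * \prod_(i < n) t 0 i ^+ b i.
Proof.
have E : line_monomial t (- t) b =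
    (\prod_(i < n) t 0 i ^+ b i)%:P * (1 - 'X) ^+ mdeg b.
  rewrite mdegE -prodrXr rmorph_prod -big_split; apply: eq_bigr => i _ /=.
  by rewrite rmorphXn /= -exprMn mxE scaleNr -mul_polyC mulrBr mulr1.
rewrite /tangent_monomial E derivM derivC mul0r add0r deriv_exp derivB derivX.
rewrite derivC sub0r.
rewrite !hornerE hornerMn mulN1r hornerN horner_exp !hornerE subr0 !expr1n.
by rewrite mulNrn -mulrDr mulrC.
Qed.

(** Over the polynomial ring, the monomial on the translated line is a binomial transform with
    constant coefficients. The functional p |-> p(0) + p'(0) is linear and commutes with it. *)
Lemma binomial_transform_tangent A u t v a :
  uniq A -> (forall b, (b <= a)%MM -> b \in A) ->
  binomial_transform A (u 0) (tangent_monomial t v) a =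
    tangent_monomial (u + t) v a.
Proof.
move=> uA downA.
have -> : tangent_monomial (u + t) v a =
  (binomial_transform A (fun i => (u 0 i)%:P) (line_monomial t v) a).[0] +
  (binomial_transform A (fun i => (u 0 i)%:P) (line_monomial t v) a)^`().[0].
  rewrite /tangent_monomial; suff -> : line_monomial (u + t) v a =
    binomial_transform A (fun i => (u 0 i)%:P) (line_monomial t v) a by [].
  rewrite (binomial_transform_monomial _ _ uA downA); apply: eq_bigr => i _.
  by rewrite mxE polyCD addrA.
rewrite /binomial_transform raddf_sum /= !horner_sum -big_split.
apply: eq_bigr => b _ /=; set c := (X in X * tangent_monomial _ _ _).
rewrite (_ : \prod_(i < n) _ = c%:P).
  by rewrite derivM derivC mul0r add0r !hornerM hornerC mulrDr.
by rewrite rmorph_prod; apply: eq_bigr => i _; rewrite rmorphMn rmorphXn.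
Qed.

End TangentMonomials.

(** * Coordinates addressed by exponents *)

Section Entries.
Variables (K : fieldType) (n : nat).
Implicit Types (A : seq 'X_{1..n}) (a b : 'X_{1..n}).

(* The default 1 is the value of the monomial of exponent 0, which T_Delta omits. *)
Definition entry A (x : 'rV[K]_(size A)) b : K :=
  oapp (x 0) 1 (insub (index b A)).

Lemma entry_notin A (x : 'rV[K]_(size A)) b : b \notin A -> entry x b = 1.
Proof. by rewrite -index_mem /entry; case: insubP => // k ->. Qed.

Lemma entry_row A (F : 'X_{1..n} -> K) b :
  b \in A -> entry (\row_(k < size A) F (nth 0%MM A k)) b = F b.
Proof.
move=> bA; rewrite /entry; case: insubP => [k _ kE|].
  by rewrite /= mxE kE nth_index.
by rewrite index_mem bA.
Qed.

Lemma polynomial_fun_entry A b :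
  polynomial_fun (fun x : 'rV[K]_(size A) => entry x b).
Proof.
rewrite /entry; case: insub => [k|]; first exact: polynomial_fun_coord.
exact: polynomial_funC.
Qed.

Lemma polynomial_fun_binomial_transform N A (s : 'I_n -> 'rV[K]_N -> K)
    (F : 'X_{1..n} -> 'rV[K]_N -> K) a :
  (forall i, polynomial_fun (s i)) -> (forall b, polynomial_fun (F b)) ->
  polynomial_fun
    (fun x => binomial_transform A (fun i => s i x) (fun b => F b x) a).
Proof.
move=> ps pF; apply: polynomial_fun_sum => b; apply: polynomial_funM => //.
apply: polynomial_fun_prod => i.
apply: (@polynomial_fun_ext _ _
  (fun x => s i x ^+ (a i - b i) * 'C(a i, b i)%:R)) => [x|].
  by rewrite mulr_natr.
exact/polynomial_funM/polynomial_funC/polynomial_funX.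
Qed.

End Entries.

(** * Tangent lines to the closure of a monomial parametrization *)

Section TangentialVariety.
Variables (K : numFieldType) (n : nat) (A : seq 'X_{1..n}).
Variable kU : 'I_n -> 'I_(size A).
Hypothesis kUE : forall i, nth 0%MM A (kU i) = U_(i)%MM.

(** In characteristic 0 the natural numbers are distinct, so they give more roots than the degree
    allows. *)
Lemma poly_eq0_horner (p : {poly K}) : (forall s, p.[s] = 0) -> p = 0.
Proof.
move=> p0; apply: (@roots_geq_poly_eq0 _ p [seq i%:R | i <- iota 0 (size p)]).
- by apply/allP => s _; rewrite rootE p0.
- by rewrite map_inj_uniq ?iota_uniq //; apply: mulrIn; rewrite oner_eq0.
- by rewrite size_map size_iota.
Qed.

(** A polynomial vanishing on [Y] becomes identically zero along the curve; its derivative at 0 is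
    then read off by the chain rule. *)
Lemma tangent_vector_curve N (Y : set 'rV[K]_N) (q : 'I_N -> {poly K}) :
  (forall s, Y (\row_i (q i).[s])) ->
  tangent_vector Y (\row_i (q i).[0]) (\row_i (q i)^`().[0]).
Proof.
move=> Yq p pY.
have p0 : mmap polyC q p = 0.
  apply: poly_eq0_horner => s; rewrite mmap_curveE -[RHS](pY _ (Yq s)).
  by apply: meval_eq => i; rewrite mxE.
rewrite -[RHS](horner0 0) -deriv0 -p0 mmap_curve_deriv.
apply: eq_bigr => i _; rewrite !mxE; congr (_ * _).
by apply: meval_eq => j; rewrite mxE.
Qed.

(** The closure is a graph over its degree-one coordinates [kU i]: these equations hold at
    parametrized points and, being polynomial, on the closure. *)
Lemma monomial_map_closureE x k :
  zariski_closure (range (@monomial_map K n A)) x ->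
  x 0 k = \prod_(i < n) x 0 (kU i) ^+ nth 0%MM A k i.
Proof.
move=> clx; pose g (z : 'rV[K]_(size A)) : 'rV[K]_(size A) :=
  \row_k \prod_(i < n) z 0 (kU i) ^+ nth 0%MM A k i.
suff xg : x = g x by rewrite {1}xg mxE.
apply: (@polynomial_map_eq_closure _ _ _ idfun g) clx.
- exact: polynomial_map_id.
- apply/polynomial_mapP => j; rewrite /g.
  apply: (@polynomial_fun_ext _ _
      (fun z => \prod_(i < n) z 0 (kU i) ^+ nth 0%MM A j i)) => [z|].
    by rewrite mxE.
  by apply: polynomial_fun_prod => i; apply/polynomial_funX/polynomial_fun_coord.
move=> _ [t _ <-]; apply/rowP => j; rewrite /g !mxE; apply: eq_bigr => i _.
rewrite mxE kUE (bigD1 i) //= big1 => [|l /negPf li].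
  by rewrite mnm1E eqxx expr1 mulr1.
by rewrite mnm1E eq_sym li.
Qed.

Lemma tangent_vector_monomial_closure y v k :
  let Y := zariski_closure (range (@monomial_map K n A)) in
  Y y -> tangent_vector Y y v ->
  v 0 k = (line_monomial (\row_i y 0 (kU i)) (\row_i v 0 (kU i))
             (nth 0%MM A k))^`().[0].
Proof.
move=> Y Yy tang; pose a := nth 0%MM A k.
(* [p] is the graph equation of coordinate [k]. The line [q] need not lie in [Y]; it only turns the
   gradient sum into a derivative at 0. *)
pose p : {mpoly K[size A]} := 'X_k - \prod_(i < n) 'X_(kU i) ^+ a i.
pose q j := (y 0 j)%:P + v 0 j *: 'X.
have q0 j : (q j).[0] = y 0 j by rewrite /q !hornerE.
have q'0 j : (q j)^`().[0] = v 0 j.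
  by rewrite /q derivD derivC derivZ derivX add0r !hornerE.
have pY : vanishes_on p Y.
  move=> z Yz; rewrite mevalB mevalXU (monomial_map_closureE k Yz) rmorph_prod.
  apply/eqP; rewrite subr_eq0; apply/eqP/eq_bigr => i _.
  by rewrite rmorphXn /= mevalXU.
have /eqP := tang p pY.
have -> : \sum_(i < size A) (p^`M(i)).@[y 0] * v 0 i = (mmap polyC q p)^`().[0].
  rewrite mmap_curve_deriv; apply: eq_bigr => i _; rewrite q'0; congr (_ * _).
  exact: meval_eq.
rewrite mmapB mmapX mmap1U derivB hornerD hornerN q'0 subr_eq0 => /eqP ->.
congr (_^`().[0]); rewrite rmorph_prod; apply: eq_bigr => i _.
by rewrite rmorphXn /= mmapX mmap1U !mxE.
Qed.

Lemma tangent_lines_monomial_closureP (x : 'rV[K]_(size A)) : (0 < n)%N ->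
  tangent_lines_union (zariski_closure (range (@monomial_map K n A))) x <->
  exists t v : 'rV[K]_n,
    x = \row_(k < size A) tangent_monomial t v (nth 0%MM A k).
Proof.
move=> n_gt0; split=> [[y [v [Yy v0 tang [s ->]]]]|[t [v ->]]].
  (* The degree-one coordinates recover the base point and the direction; [s] is absorbed into the
     direction. *)
  exists (\row_i y 0 (kU i)), (s *: \row_i v 0 (kU i)); apply/rowP => k.
  rewrite !mxE tangent_monomialZ -tangent_vector_monomial_closure //.
  congr (_ + _); rewrite (monomial_map_closureE k Yy) horner_line_monomial.
  by apply: eq_bigr => i _; rewrite scale0r addr0 mxE.
(* A tangent line needs a nonzero direction: if [v = 0], take [s = 0] and the all-ones vector, which
   is nonzero since [n > 0]. *)
have [s [w [w0 ->]]] : exists (s : K) (w : 'rV_n), w != 0 /\ v = s *: w.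
  have [->|v0] := eqVneq v 0; last by exists 1, v; rewrite scale1r.
  exists 0, (const_mx 1); rewrite scale0r; split=> //.
  by apply/eqP => /rowP/(_ (Ordinal n_gt0))/eqP; rewrite !mxE oner_eq0.
pose q k := line_monomial t w (nth 0%MM A k).
have Yq r : zariski_closure (range (@monomial_map K n A)) (\row_k (q k).[r]).
  apply: sub_zariski_closure; exists (t + r *: w) => //.
  by apply/rowP => k; rewrite !mxE horner_line_monomial.
exists (\row_k (q k).[0]), (\row_k (q k)^`().[0]); split=> //.
- apply: contra_neq w0 => /rowP q'0; apply/rowP => i.
  by have := q'0 (kU i); rewrite !mxE /q kUE deriv_line_monomial1 hornerC.
- exact: tangent_vector_curve.
- by exists s; apply/rowP => k; rewrite !mxE tangent_monomialZ.
Qed.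

End TangentialVariety.

(** * Central moments for a down-closed list of exponents *)

Theorem tangential_variety_monomial (K : numFieldType) n (A B : seq 'X_{1..n}) :
  (0 < n)%N -> uniq A ->
  (forall a b, a \in A -> (b <= a)%MM -> b \in A) ->
  (forall i, U_(i)%MM \in A) ->
  (forall b, (b \in B) = (b \in A) && (1 < mdeg b)%N) ->
  variety_isomorphic
    (tangential_variety (zariski_closure (range (@monomial_map K n A))))
    (variety_prod [set: 'rV[K]_n]%classic
      (zariski_closure (range (@monomial_map K n B)))).
Proof.
move=> n_gt0 uA downA UA memB.
have /fin_all_exists[kU kUE] : forall i,
    exists k : 'I_(size A), nth 0%MM A k = U_(i)%MM.
  move=> i; have ltA : (index U_(i)%MM A < size A)%N by rewrite index_mem.
  by exists (Ordinal ltA); rewrite /= nth_index.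
pose mean (x : 'rV[K]_(size A)) := \row_i x 0 (kU i).
(* [f] lists the mean and the central moments of degree at least 2, each divided by 1 - |a|; [g]
   multiplies back and undoes the recentring. *)
pose f (x : 'rV[K]_(size A)) := row_mx (mean x)
  (\row_(j < size B) ((1 - (mdeg (nth 0%MM B j))%:R)^-1 *
     binomial_transform A ((- mean x) 0) (entry x) (nth 0%MM B j))).
pose g (z : 'rV[K]_(n + size B)) : 'rV[K]_(size A) :=
  \row_(k < size A) binomial_transform A (lsubmx z 0)
    (fun b => (1 - (mdeg b)%:R) * entry (rsubmx z) b) (nth 0%MM A k).
have fE t v : f (\row_(k < size A) tangent_monomial t v (nth 0%MM A k)) =
    row_mx (t + v) (monomial_map B (- v)).
  rewrite /f; set x := \row_k _.
  have -> : mean x = t + v.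
    by apply/rowP => i; rewrite !mxE kUE tangent_monomial1.
  congr row_mx; apply/rowP => j; rewrite !mxE.
  have := mem_nth 0%MM (ltn_ord j); rewrite memB; set a := nth _ _ _.
  case/andP=> aA a_gt1.
  (* Translation by -(t + v) moves the base point to [- v], whose negative is the direction, so the
     cone formula applies. *)
  have -> : binomial_transform A ((- (t + v)) 0) (entry x) a =
      tangent_monomial (- v) (- - v) a.
    have -> : - v = - (t + v) + t by rewrite opprD addrAC addNr add0r.
    rewrite -(binomial_transform_tangent _ _ _ uA); last first.
      by move=> b /(downA _ _ aA).
    rewrite opprD addrAC addNr add0r opprK.
    apply: eq_big_seq => b bA; congr (_ * _); exact: entry_row.
  rewrite tangent_monomial_cone mulKf // subr_eq0 eq_sym.
  by rewrite (eqr_nat _ _ 1) gtn_eqF.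
have gE u w : g (row_mx u (monomial_map B w)) =
    \row_(k < size A) tangent_monomial (u + w) (- w) (nth 0%MM A k).
  apply/rowP => k; rewrite !mxE row_mxKl row_mxKr.
  have aA := mem_nth 0%MM (ltn_ord k).
  rewrite -(binomial_transform_tangent _ _ _ uA); last first.
    by move=> b /(downA _ _ aA).
  apply: eq_big_seq => b bA; congr (_ * _); rewrite tangent_monomial_cone.
  (* Outside [B] the degree is at most 1. In degree 1 the factor 1 - |b| is 0; in degree 0 the
     default entry 1 is the value of the empty product. *)
  have [bB|bB] := boolP (b \in B).
    by congr (_ * _); rewrite /monomial_map (entry_row
      (fun b : 'X_{1..n} => \prod_(i < n) w 0 i ^+ b i)).
  rewrite entry_notin //; move: bB; rewrite memB bA /= -leqNgt.
  rewrite leq_eqVlt ltnS leqn0 => /orP[/eqP->|]; first by rewrite subrr !mul0r.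
  rewrite mdeg_eq0 => /eqP->; congr (_ * _); rewrite big1 // => i _.
  by rewrite mnm0E expr0.
have PT := tangent_lines_monomial_closureP kUE _ n_gt0.
apply: (@closure_isomorphic_setT_prod _ _ _ _ _ _ f g).
- apply: polynomial_map_row_mx; apply/polynomial_mapP => j.
    apply: polynomial_fun_ext (polynomial_fun_coord _ (kU j)) => x.
    by rewrite mxE.
  pose h (x : 'rV[K]_(size A)) := (1 - (mdeg (nth 0%MM B j))%:R)^-1 *
    binomial_transform A (fun i => - x 0 (kU i)) (entry x) (nth 0%MM B j).
  apply: (@polynomial_fun_ext _ _ h) => [x|].
    rewrite mxE; congr (_ * _); apply: eq_bigr => b _; congr (_ * _).
    by apply: eq_bigr => i _; rewrite !mxE.
  apply: polynomial_funM; first exact: polynomial_funC.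
  apply: polynomial_fun_binomial_transform => [i|b].
    exact/polynomial_funN/polynomial_fun_coord.
  exact: polynomial_fun_entry.
- apply/polynomial_mapP => k.
  pose h (z : 'rV[K]_(n + size B)) :=
    binomial_transform A (fun i => z 0 (lshift _ i))
      (fun b => (1 - (mdeg b)%:R) * entry (rsubmx z) b) (nth 0%MM A k).
  apply: (@polynomial_fun_ext _ _ h) => [z|].
    rewrite mxE; apply: eq_bigr => b _; congr (_ * _).
    by apply: eq_bigr => i _; rewrite !mxE.
  apply: polynomial_fun_binomial_transform => [i|b].
    exact: polynomial_fun_coord.
  apply: polynomial_funM; first exact: polynomial_funC.
  exact: (polynomial_fun_comp (@polynomial_fun_entry _ _ _ b)
    (@polynomial_map_rsubmx _ _ _)).
- move=> x /PT[t [v ->]]; rewrite fE row_mxKr gE; split.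
    by exists (- v).
  by rewrite opprK addrK.
- move=> u _ [w _ <-]; rewrite gE fE opprK addrK; split=> //.
  by apply/PT; exists (u + w), (- w).
Qed.

(** * Label multisets as a down-closed list of exponents *)

Section LabelClasses.
Variables (n : nat) (V : finType) (lab : V -> 'I_n).
Implicit Types (D : {set {set V}}) (s : {set V}).

Lemma mem_label_classes D m :
  reflect (exists2 s, s \in D & m = label_multiset lab s)
    (m \in label_classes lab D).
Proof.
rewrite mem_undup; apply: (iffP mapP) => -[s sD ->].
  by exists s; rewrite // -mem_enum.
by exists s; rewrite // mem_enum.
Qed.

Lemma mdeg_label_multiset s : mdeg (label_multiset lab s) = #|s|.
Proof.
rewrite mdegE -sum1_card (partition_big lab predT) //=.
apply: eq_bigr => i _; rewrite mnmE -sum1_card.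
by apply: eq_bigl => v; rewrite !inE.
Qed.

Lemma label_multiset1 v : label_multiset lab (finset.set1 v) = U_(lab v)%MM.
Proof.
apply/mnmP => i; rewrite mnmE mnm1E; case: eqP => [<-|ne].
  rewrite -[RHS](card1 v); apply: eq_card => w; rewrite !inE.
  by case: (w =P v) => // ->; rewrite eqxx.
apply: eq_card0 => w; rewrite !inE; case: (w =P v) => // ->.
exact/eqP.
Qed.

(** For each label [i], keep [b i] of the vertices of [s] labelled [i]; these choices are
    independent since the label classes are disjoint. *)
Lemma label_multiset_sub s b : (b <= label_multiset lab s)%MM ->
  exists2 t : {set V}, t \subset s & label_multiset lab t = b.
Proof.
move=> /mnm_lepP le_bs.
pose T i := take (b i) (enum [pred v in s | lab v == i]).
have T_s v i : v \in T i -> (v \in s) && (lab v == i).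
  by move=> /mem_take; rewrite mem_enum inE.
exists (finset (fun v => v \in T (lab v))).
  by apply/fintype.subsetP => v; rewrite inE => /T_s/andP[].
apply/mnmP => i; rewrite mnmE.
transitivity #|T i|.
  apply: eq_card => v; rewrite !inE.
  apply/andP/idP => [[vT /eqP <-]//|vT].
  by have /andP[_ /eqP li] := T_s _ _ vT; rewrite li.
rewrite (card_uniqP _) ?take_uniq ?enum_uniq // size_takel // -cardE.
by have := le_bs i; rewrite mnmE.
Qed.

(** The degree of a label multiset is the number of vertices, so identified simplices have the same
    dimension. *)
Lemma label_classes_dim_ge1 D b :
  (b \in label_classes lab (dim_ge1 D)) =
    (b \in label_classes lab D) && (1 < mdeg b)%N.
Proof.
apply/mem_label_classes/andP => [[s]|[/mem_label_classes[s sD ->]]].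
  rewrite inE => /andP[sD s2] ->; rewrite mdeg_label_multiset; split=> //.
  by apply/mem_label_classes; exists s.
by rewrite mdeg_label_multiset => s2; exists s; rewrite // inE sD.
Qed.

End LabelClasses.

Theorem theorem2p9 (R : realType) (n : nat) (V : finType) (D : {set {set V}})
    (lab : V -> 'I_n)
    (complexD : simplicial_complex D)
    (connectedD : complex_connected D)
    (lab_surj : forall i : 'I_n, exists v : V, lab v = i) :
  variety_isomorphic
    (tangential_variety (V_Delta R[i] lab D))
    (variety_prod (@classical_sets.setT 'rV[R[i]]_n) (T_Delta R[i] lab D)).
Proof.
(* Connectedness supplies a vertex, and its label shows [n > 0]. *)
have [_ subD D1] := complexD; have [/card_gt0P[v0 _] _] := connectedD.
apply: tangential_variety_monomial.
- exact: leq_ltn_trans (ltn_ord (lab v0)).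
- exact: undup_uniq.
- move=> a b /mem_label_classes[s sD ->] /label_multiset_sub[t ts <-].
  by apply/mem_label_classes; exists t => //; apply: subD ts sD.
- move=> i; have [v <-] := lab_surj i; apply/mem_label_classes.
  by exists (finset.set1 v); rewrite ?label_multiset1.
- exact: label_classes_dim_ge1.
Qed.
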